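(* For each $p \in \mathbb{C}$, the set $$\{\alpha \in \mathbb{R} : \overline{\exp \circ \exp (L_\alpha(p))} = \mathbb{C}\}$$ is residual in $\mathbb{R}$.
   Context: Here $\exp : \mathbb{C} \to \mathbb{C}$, $z \mapsto e^z$, is the complex exponential. For $p \in \mathbb{C}$ and $\alpha \in \mathbb{R}$, $L_\alpha(p) := \{p + t(i+\alpha) : t \in \mathbb{R}\}$ is a (non-horizontal) line through $p$. The overline denotes closure in $\mathbb{C}$. A set is called residual if it can be written as a countable intersection of open, dense sets. *)

(* Defs.v *)
From mathcomp Require Import all_boot all_order all_algebra.
From mathcomp Require Import all_classical all_reals all_analysis.
From mathcomp Require Import complex ring.
Import Order.TTheory GRing.Theory Num.Theory.
Import numFieldNormedType.Exports.

Set Implicit Arguments.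
Unset Strict Implicit.
Unset Printing Implicit Defensive.

Local Open Scope classical_set_scope.
Local Open Scope ring_scope.
Local Open Scope complex_scope.

(* MathComp-Analysis has no complex exponential: this is the definition of
   [expR] (sum of the exponential power series) with [R[i]] in place of [R].
   [R[i]] itself carries no topology; its regular module [R[i]^o] carries the
   one given by the modulus. *)
Definition Cexp (R : realType) (z : R[i]) : R[i] :=
  limn (series (fun n => z ^+ n / n`!%:R) : (R[i]^o)^nat).

Definition line (R : realType) (p : R[i]) (alpha : R) : set R[i] :=
  [set p + t%:C * ('i + alpha%:C) | t in [set: R]].

Section CexpE.

Let e (K : numFieldType) (x : K) (n : nat) : K := x ^+ n / n`!%:R.

Let eD (K : numFieldType) (x y : K) n :
  e (x + y) n = \sum_(0 <= i < n.+1) e x i * e y (n - i)%N.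
Proof.
rewrite /e addrC exprDn mulr_suml big_mkord; apply: eq_bigr => i _.
have f0 k : k`!%:R != 0 :> K by rewrite pnatr_eq0 -lt0n fact_gt0.
have le_in : (i <= n)%N by rewrite -ltnS.
rewrite -[in RHS](mulr_natr) -(bin_fact le_in) !natrM.
have b0 : 'C(n, i)%:R != 0 :> K by rewrite pnatr_eq0 -lt0n bin_gt0.
rewrite -mulr_natr; field; rewrite !f0 b0 //.
Qed.

Let seD (K : numFieldType) (x y : K) n :
  \sum_(0 <= k < n) e (x + y) k =
  \sum_(0 <= i < n) e x i * \sum_(0 <= j < n - i) e y j.
Proof.
elim: n => [|n IH]; first by rewrite !big_geq.
rewrite big_nat_recr //= IH eD big_nat_recr //= [in RHS]big_nat_recr //=.
rewrite addrA -big_split /= subSnn subnn big_nat1; congr (_ + _).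
rewrite [LHS]big_nat [RHS]big_nat; apply: eq_bigr => i /andP[_ lin].
by rewrite subSn 1?ltnW // [in RHS]big_nat_recr //= mulrDr.
Qed.

Let seB (K : numFieldType) (x y : K) n :
  (\sum_(0 <= k < n) e x k) * (\sum_(0 <= k < n) e y k) -
    \sum_(0 <= k < n) e (x + y) k =
  \sum_(0 <= i < n) e x i * \sum_(n - i <= j < n) e y j.
Proof.
rewrite seD mulr_suml -sumrB; apply: eq_bigr => i _.
rewrite -mulrBr (big_cat_nat (leq0n (n - i)) (leq_subr i n)) /=.
by rewrite addrAC subrr add0r.
Qed.

Let normr_e (K : numFieldType) (x : K) n : `|e x n| = e `|x| n.
Proof. by rewrite /e normrM normrX normfV (ger0_norm (ler0n _ _)). Qed.

Let seB_le (K : numFieldType) (x y : K) n :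
  `|(\sum_(0 <= k < n) e x k) * (\sum_(0 <= k < n) e y k) -
    \sum_(0 <= k < n) e (x + y) k| <=
  (\sum_(0 <= k < n) e `|x| k) * (\sum_(0 <= k < n) e `|y| k) -
    \sum_(0 <= k < n) e (`|x| + `|y|) k.
Proof.
rewrite !seB; apply: (le_trans (ler_norm_sum _ _ _)); apply: ler_sum => i _.
rewrite normrM normr_e ler_wpM2l -?normr_e //.
apply: (le_trans (ler_norm_sum _ _ _)); apply: ler_sum => j _.
by rewrite normr_e.
Qed.

Variable R : realType.

Let cvg_real_complex (f : R^nat) (g : (R[i]^o)^nat) (l : R[i]^o) :
  f @ \oo --> 0 -> (forall n, `|l - g n| <= (f n)%:C) -> g @ \oo --> l.
Proof.
move=> /cvgrPdist_lt f0 fg; apply/cvgrPdist_lt => eps eps0.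
have epsE : eps = (complex.Re eps)%:C.
  by move: eps0; case: eps => a b; rewrite ltcE /= => /andP[/eqP -> _].
move: eps0; rewrite epsE ltcR => eps0.
near=> n; apply: le_lt_trans (fg n) _; rewrite ltcR.
apply: le_lt_trans (ler_norm _) _; rewrite -normrN -[- _]add0r.
by near: n; exact: f0.
Unshelve. all: by end_near. Qed.

Let cvg_ReIm (f g : R^nat) (a b : R) : f @ \oo --> a -> g @ \oo --> b ->
  (fun n => f n +i* g n : R[i]^o) @ \oo --> (a +i* b : R[i]^o).
Proof.
move=> fa gb.
apply: (@cvg_real_complex (fun n => `|a - f n| + `|b - g n|)).
  have d0 (h : R^nat) (c : R) : h @ \oo --> c -> (fun n => `|c - h n|) @ \oo --> 0.
    move=> hc; rewrite -(@normr0 _ R) -(subrr c).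
    by apply: cvg_norm; apply: cvgB => //; exact: cvg_cst.
  by rewrite -[0 in X in _ --> X](addr0 (0 : R)); apply: cvgD; exact: d0.
move=> n.
have -> : (a +i* b : R[i]) - (f n +i* g n) = (a - f n)%:C + (b - g n)%:C * 'i.
  by simpc.
apply: (le_trans (ler_normD _ _)); rewrite [leRHS]rmorphD /=.
apply: lerD.
  by rewrite normc_def /= expr0n /= addr0 sqrtr_sqr.
by rewrite normrM !normc_def /= !expr0n /= !(addr0, add0r) sqrtr_sqr expr1n sqrtr1 mulr1.
Qed.

Let e_real (x : R) n : e x%:C n = (e x n)%:C.
Proof. by rewrite /e rmorphM /= rmorphXn fmorphV rmorph_nat. Qed.

Let e_imag (y : R) n : e ('i * y%:C) n = cos_coeff y n +i* sin_coeff y n.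
Proof.
have sqri : 'i ^+ 2 = -1 :> R[i] by rewrite expr2; simpc.
have -> : e ('i * y%:C) n = 'i ^+ n * (e y n)%:C.
  by rewrite -e_real /e exprMn mulrA.
rewrite /cos_coeff /sin_coeff /e /= -!mulrA.
set c := y ^+ n / _; rewrite -{1}(odd_double_half n) exprD.
have sgnE (k : nat) : (-1 : R[i]) ^+ k = ((-1) ^+ k)%:C by rewrite rmorphXn rmorphN1.
rewrite -mul2n exprM sqri sgnE -exprnP.
have [on|on] /= := boolP (odd n); last by simpc.
have -> : n.-1./2 = n./2 by case: n on {c} => // m /= om; rewrite uphalf_half (negbTE om).
by simpc.
Qed.

Let se_imag (y : R) n : \sum_(0 <= k < n) e ('i * y%:C) k =
  series (cos_coeff y) n +i* series (sin_coeff y) n.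
Proof.
rewrite /series /=; elim: n => [|n IH]; first by rewrite !big_geq.
by rewrite !big_nat_recr //= IH e_imag; simpc.
Qed.

(* The limit in [Cexp] exists, so that [limn] takes no default value. *)
Lemma cvg_series_Cexp (z : R[i]) :
  (series (fun n => z ^+ n / n`!%:R) : (R[i]^o)^nat) @ \oo -->
  ((expR (complex.Re z))%:C * (cos (complex.Im z) +i* sin (complex.Im z)) : R[i]^o).
Proof.
set x := complex.Re z; set y := complex.Im z.
have zE : z = x%:C + 'i * y%:C by rewrite {1}(complexE z).
pose s (u : R) n := \sum_(0 <= k < n) e u k.
have cs u : s u @ \oo --> expR u by exact: is_cvg_series_exp_coeff.
have sC (u : R) n : \sum_(0 <= k < n) e u%:C k = (s u n)%:C.
  by rewrite rmorph_sum; apply: eq_bigr => k _; exact: e_real.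
pose P n : R[i]^o := (s x n * series (cos_coeff y) n) +i*
                     (s x n * series (sin_coeff y) n).
have cP : P @ \oo --> ((expR x)%:C * (cos y +i* sin y) : R[i]^o).
  have -> : (expR x)%:C * (cos y +i* sin y) = (expR x * cos y) +i* (expR x * sin y).
    by simpc.
  apply: cvg_ReIm; apply: cvgM => //.
    by rewrite unlock; exact: is_cvg_series_cos_coeff.
  by rewrite unlock; exact: is_cvg_series_sin_coeff.
pose D n : R[i]^o := P n - \sum_(0 <= k < n) e z k.
have cD : D @ \oo --> (0 : R[i]^o).
  apply: (@cvg_real_complex (fun n => s `|x| n * s `|y| n - s (`|x| + `|y|) n)).
    rewrite -[0 in X in _ --> X](subrr (expR (`|x| + `|y|))) {1}expRD.
    by apply: cvgB => //; apply: cvgM.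
  move=> n; rewrite sub0r normrN /D zE.
  have -> : P n = (\sum_(0 <= k < n) e x%:C k) * \sum_(0 <= k < n) e ('i * y%:C) k.
    by rewrite sC se_imag /P; simpc.
  have nx : `|x%:C| = `|x|%:C.
    by rewrite normc_def /= expr0n /= addr0 sqrtr_sqr.
  have ny : `|'i * y%:C| = `|y|%:C.
    by rewrite normrM !normc_def /= !expr0n /= !(addr0, add0r) !sqrtr_sqr normr1 mul1r.
  apply: le_trans (seB_le _ _ _) _.
  by rewrite nx ny -rmorphD !sC -rmorphM -rmorphB.
rewrite -[X in _ --> X]subr0.
rewrite (_ : series _ = P \- D); first exact: cvgB.
by apply/funext => n; rewrite /D /= opprB addrC subrK.
Qed.

Lemma CexpE (z : R[i]) :
  Cexp z = (expR (complex.Re z))%:C * (cos (complex.Im z) +i* sin (complex.Im z)).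
Proof. exact: (cvg_lim (@norm_hausdorff _ R[i]^o) (@cvg_series_Cexp z)). Qed.

End CexpE.

(* Main.v *)
Require Import Defs.
From mathcomp Require Import all_boot all_order all_algebra.
From mathcomp Require Import all_classical all_reals all_analysis.
From mathcomp Require Import borel_hierarchy complex.
From mathcomp Require Import ring lra.
Import Order.TTheory GRing.Theory Num.Theory.
Import numFieldNormedType.Exports.

Set Implicit Arguments.
Unset Strict Implicit.
Unset Printing Implicit Defensive.

Local Open Scope classical_set_scope.
Local Open Scope ring_scope.
Local Open Scope complex_scope.

(** The slope set is a countable intersection of open dense sets, one for each
square Q of a countable base of the plane: the set of slopes alpha such that
exp (exp (line p alpha)) meets Q.  The image of the line is dense exactly when
alpha lies in all of them.

Openness: for a fixed parameter t, exp (exp (p + t (i + alpha))) is continuous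
in alpha, so the set is a union over t of open preimages.

Density ([line_hits]): if w != 0 and a < b have the same sign, then some slope
in ]a, b[ gives a line through a point u with exp (exp u) = w exactly.  The
logarithms of w form a vertical progression z0 + 2 pi i k; choosing k large and
taking a logarithm again gives u with exp (exp u) = w and real part as large as
desired ([exists_log_large_Re]).  The translates u + 2 pi i m have the same
image, and the slope of the line joining p to such a translate is
(Re u - Re p) / (Im u - Im p + 2 pi m).  It lies in ]a, b[ as soon as the
denominator lies in an interval of length (Re u - Re p) (1/a - 1/b).  This
length exceeds the step 2 pi when Re u is large, so a suitable m exists.

Any open set of slopes contains such an interval ]a, b[ avoiding 0, and any
square contains a nonzero w, so the value 0, which exp omits, is harmless. *)

(** * The complex exponential in real coordinates *)

Section ComplexExponential.
Context {R : realType}.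
Implicit Types (x y a b : R) (z w p : R[i]).

Lemma Re_Cexp z :
  complex.Re (Cexp z) = expR (complex.Re z) * cos (complex.Im z).
Proof. by rewrite CexpE; simpc. Qed.

Lemma Im_Cexp z :
  complex.Im (Cexp z) = expR (complex.Re z) * sin (complex.Im z).
Proof. by rewrite CexpE; simpc. Qed.

Lemma periodic_int (U V : zmodType) (f : U -> V) (T : U) :
  periodic f T -> forall (m : int) u, f (u + T *~ m) = f u.
Proof.
move=> fT [n|n] u; first exact: periodicn.
by rewrite NegzE mulrNz -(periodicn fT n.+1 (u - _)) subrK.
Qed.

Lemma Cexp_periodic (m : int) x y :
  Cexp (x +i* (y + (pi *+ 2) *~ m)) = Cexp (x +i* y).
Proof.
by rewrite !CexpE /= (periodic_int (@cosD2pi R)) (periodic_int (@sinD2pi R)).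
Qed.

Lemma unit_circle_cos_sin a b :
  a ^+ 2 + b ^+ 2 = 1 -> exists2 y, cos y = a & sin y = b.
Proof.
move=> ab1.
have a1 : -1 <= a <= 1 by apply/andP; split; nra.
have sinE : sin (acos a) = `|b|.
  by rewrite sin_acos // -ab1 addrAC subrr add0r sqrtr_sqr.
have cosE : cos (acos a) = a by apply: acosK; rewrite in_itv.
have [b0|b0] := leP 0 b; first by exists (acos a); rewrite ?sinE ?ger0_norm.
by exists (- acos a); rewrite ?cosN ?sinN ?sinE ?ltr0_norm ?opprK.
Qed.

Lemma Cexp_surjective w : w != 0 -> exists z, Cexp z = w.
Proof.
case: w => a b; rewrite eq_complex /= negb_and => ab0.
have n0 : 0 < a ^+ 2 + b ^+ 2.
  have [a2 b2] := (sqr_ge0 a, sqr_ge0 b).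
  rewrite lt_neqAle addr_ge0 // andbT eq_sym paddr_eq0 // !sqrf_eq0.
  by rewrite negb_and.
pose r := Num.sqrt (a ^+ 2 + b ^+ 2).
have r0 : 0 < r by rewrite sqrtr_gt0.
have rne0 : r != 0 by rewrite gt_eqF.
have rr : r ^+ 2 = a ^+ 2 + b ^+ 2 by rewrite sqr_sqrtr ?ltW.
have [|y cosE sinE] := @unit_circle_cos_sin (a / r) (b / r).
  by rewrite !expr_div_n -mulrDl -rr divff // expf_neq0.
exists (ln r +i* y); rewrite CexpE /= cosE sinE lnK ?posrE //.
by simpc; rewrite !(mulrC r) !divfK.
Qed.

(** * Lines through a given point that hit a given value *)

(** The lines are graphs over the imaginary axis, so alpha is the increment of
the real part per unit of imaginary part. *)
Lemma line_graph p alpha z :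
  complex.Re z - complex.Re p = alpha * (complex.Im z - complex.Im p) ->
  line p alpha z.
Proof.
case: z p => zx zy [px py] /= h; exists (zy - py) => //.
by simpc; congr (_ +i* _); lra.
Qed.

Lemma exists_translate_itv y T lo hi :
  0 < T -> T < hi - lo -> exists m : int, lo < y + T *~ m < hi.
Proof.
move=> T0 Tlohi; set q := (lo - y) / T.
exists (Num.floor q + 1).
have : (Num.floor q)%:~R <= q by rewrite -floor_ge_int.
have := floorD1_gt q; rewrite -[T *~ _]mulrzr intrD /q.
set m := (Num.floor _)%:~R; rewrite ltr_pdivrMr // ler_pdivlMr //.
by move=> h1 h2; apply/andP; split; lra.
Qed.

(** Inversion is decreasing between two numbers of the same sign, so bounds on
the denominator y become bounds on the quotient. *)
Lemma div_itv x y a b : 0 < x -> 0 < a * b ->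
  x / b < y -> y < x / a -> a < x / y < b.
Proof.
move=> x0 ab0 hb ha.
have [a0|a0|a0] := ltgtP 0 a; last by move: ab0; rewrite -a0 mul0r ltxx.
- have b0 : 0 < b by rewrite -(pmulr_rgt0 _ a0).
  have y0 : 0 < y by apply: lt_trans hb; exact: divr_gt0.
  move: ha hb; rewrite ltr_pdivlMr // ltr_pdivrMr // => ha hb.
  by rewrite ltr_pdivlMr // ltr_pdivrMr // mulrC ha /= mulrC.
- have b0 : b < 0 by rewrite -(nmulr_rgt0 _ a0).
  have y0 : y < 0 by apply: lt_trans ha _; rewrite pmulr_rlt0 // invr_lt0.
  move: ha hb; rewrite ltr_ndivlMr // ltr_ndivrMr // => ha hb.
  by rewrite ltr_ndivlMr // ltr_ndivrMr // mulrC ha /= mulrC.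
Qed.

(** Among the logarithms v of w some have imaginary part above expR M.  For z
with Cexp z = v this gives expR M < |v| = expR (Re z). *)
Lemma exists_log_large_Re w M : w != 0 ->
  exists2 z, Cexp (Cexp z) = w & M < complex.Re z.
Proof.
move=> /Cexp_surjective[[x y] zw].
have pi2 : 0 < pi *+ 2 :> R by rewrite pmulrn_lgt0 // pi_gt0.
(* The window above expR M only has to be longer than the period. *)
have [|m /andP[m_gt _]] := @exists_translate_itv y _ (expR M)
  (expR M + pi *+ 2 + 1) pi2; first by lra.
have [|z zE] := @Cexp_surjective (x +i* (y + (pi *+ 2) *~ m)).
  rewrite eq_complex /= negb_and; apply/orP; right.
  by rewrite gt_eqF // (lt_trans (expR_gt0 M)).
exists z; first by rewrite zE Cexp_periodic.
rewrite -ltr_expR (lt_le_trans m_gt) //.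
have -> : y + (pi *+ 2) *~ m = complex.Im (Cexp z) by rewrite zE.
by rewrite Im_Cexp ger_pMr ?expR_gt0 // sin_le1.
Qed.

(** Two independent periods are at work: that of the inner exponential moves
the point along a vertical progression without changing its image, while that
of the outer one makes Re z large, hence the admissible window for this
progression longer than its step. *)
Lemma line_hits p w a b : w != 0 -> a < b -> 0 < a * b ->
  exists2 alpha, a < alpha < b &
    exists2 z, line p alpha z & Cexp (Cexp z) = w.
Proof.
move=> w0 ab ab0.
have [ane0 bne0] : a != 0 /\ b != 0.
  by apply/andP; rewrite -negb_or -mulf_eq0 gt_eqF.
have pi2 : 0 < pi *+ 2 :> R by rewrite pmulrn_lgt0 // pi_gt0.
have gap0 : 0 < a^-1 - b^-1.
  have -> : a^-1 - b^-1 = (b - a) / (a * b) by field; rewrite ane0 bne0.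
  by rewrite divr_gt0 // subr_gt0.
(* Once Re z - Re p exceeds D, the window ](Re z - Re p)/b, (Re z - Re p)/a[
   for the denominator of the slope is longer than 2 pi. *)
pose D := (pi *+ 2) / (a^-1 - b^-1).
have [z zw zM] := exists_log_large_Re (complex.Re p + D) w0.
case: z zw zM => x y /= zw zM.
pose L := x - complex.Re p.
have D0 : 0 < D by exact: divr_gt0.
have DL : D < L by rewrite /L; lra.
have L0 : 0 < L by lra.
have [|m /andP[lo hi]] := @exists_translate_itv (y - complex.Im p) _
    (L / b) (L / a) pi2.
  by rewrite -mulrBr -ltr_pdivrMr.
exists (L / (y - complex.Im p + (pi *+ 2) *~ m)); first exact: div_itv.
exists (x +i* (y + (pi *+ 2) *~ m)); last first.
  by rewrite Cexp_periodic.
apply: line_graph => /=; rewrite -/L [y + _ - _]addrAC divfK //.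
(* A zero denominator would lie in the window, which a * b > 0 excludes. *)
apply/eqP => T0; move: lo hi; rewrite T0.
rewrite pmulr_rlt0 // pmulr_rgt0 // invr_lt0 invr_gt0 => b_lt a_gt.
by lra.
Qed.

End ComplexExponential.

(** * Squares and the topology of the plane *)

Section Squares.
Context {R : realType}.
Implicit Types (x y e : R) (z w : R[i]).

(** Squares rather than discs: membership only involves the real and imaginary
parts, which are handled as real-valued functions. *)
Definition square (w : R[i]) (e : R) : set R[i] :=
  [set z | `|complex.Re z - complex.Re w| < e /\
           `|complex.Im z - complex.Im w| < e].

Definition rat_square (i : rat * rat * nat) : set R[i] :=
  square (ratr i.1.1 +i* ratr i.1.2) i.2.+1%:R^-1.

Lemma normc_ge_Im z : `|complex.Im z|%:C <= `|z|.
Proof.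
by rewrite -(normrN (complex.Im z)) -ReiNIm (le_trans (normc_ge_Re _)) //
  normrM (normc_def 'i) /= expr0n expr1n add0r sqrtr1 mulr1.
Qed.

Lemma normc_le_ReIm z : `|z| <= (`|complex.Re z| + `|complex.Im z|)%:C.
Proof.
rewrite normc_def lecR -(ler_pXn2r (ltn0Sn 1)) ?nnegrE ?sqrtr_ge0 ?addr_ge0 //.
rewrite sqr_sqrtr ?addr_ge0 ?sqr_ge0 // sqrrD !real_normK ?num_real //.
by have := mulr_ge0 (normr_ge0 (complex.Re z)) (normr_ge0 (complex.Im z)); lra.
Qed.

Lemma square_nbhs w e : 0 < e -> nbhs (w : R[i]^o) (square w e).
Proof.
move=> e0; apply/nbhs_ballP; exists e%:C; first by rewrite /= ltcR.
move=> z; rewrite -ball_normE /= distrC => zw.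
have ReB : complex.Re (z - w) = complex.Re z - complex.Re w.
  by case: z w {zw} => ? ? [? ?].
have ImB : complex.Im (z - w) = complex.Im z - complex.Im w.
  by case: z w {zw ReB} => ? ? [? ?].
split; rewrite -ltcR.
  by rewrite -ReB (le_lt_trans (normc_ge_Re _)).
by rewrite -ImB (le_lt_trans (normc_ge_Im _)).
Qed.

Lemma square_sub_ball w e : square w (e / 2) `<=` ball (w : R[i]^o) e%:C.
Proof.
move=> z [hx hy]; rewrite -ball_normE /= distrC.
apply: (le_lt_trans (normc_le_ReIm _)); rewrite ltcR.
case: z w hx hy => [x y] [x' y'] /=; lra.
Qed.

Lemma exists_rat_square w e : 0 < e ->
  exists i, rat_square i `<=` square w e.
Proof.
move=> e0; have [//|k] := @ltr_add_invr R 0 (e / 2); first by lra.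
rewrite add0r; set d := _^-1 => de.
have d0 : 0 < d by rewrite invr_gt0 ltr0n.
have itv x : x - d < x + d by lra.
have [/= q qE] := rat_in_itvoo (itv (complex.Re w)).
have [/= q' qE'] := rat_in_itvoo (itv (complex.Im w)).
exists (q, q', k); rewrite /rat_square /square /= -/d.
move: qE qE'; rewrite !in_itv /= => /andP[q1 q2] /andP[q3 q4].
move=> z /= []; rewrite !ltr_norml => /andP[? ?] /andP[? ?].
by split; apply/andP; split; lra.
Qed.

(** The rational squares form a countable base, so density can be tested on
them. *)
Lemma closure_eq_setT (S : set R[i]) :
  closure (S : set R[i]^o) = setT <-> forall i, S `&` rat_square i !=set0.
Proof.
split=> [clS [[q q'] k]|hS].
  have : closure (S : set R[i]^o) (ratr q +i* ratr q') by rewrite clS.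
  by apply; apply: square_nbhs; rewrite invr_gt0 ltr0n.
apply/seteqP; split=> // w _ B /nbhs_ballP[eps /= eps0 epsB].
(* The radii of balls are complex numbers here; a positive one is real. *)
have epsE : eps = (complex.Re eps)%:C.
  by move: eps0; case: (eps) => a b; rewrite ltcE /= => /andP[/eqP -> _].
move: eps0 epsB; rewrite epsE ltcR => eps0 epsB.
have [|i iw] := @exists_rat_square w (complex.Re eps / 2); first by lra.
have [s [Ss is_]] := hS i; exists s; split=> //.
by apply/epsB/square_sub_ball/iw.
Qed.

Lemma exists_neq0_square w e : 0 < e -> exists2 z, z != 0 & square w e z.
Proof.
move=> e0; have [w0|w0] := eqVneq w 0.
  exists (e / 2)%:C; last first.
    by rewrite /square w0 /= !subr0 normr0 ger0_norm; [split|]; lra.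
  by rewrite eq_complex /= eqxx andbT; lra.
by exists w => //; split; rewrite subrr normr0.
Qed.

Lemma open_preimage_square (T : topologicalType) (f : T -> R[i]) w e :
  continuous (@complex.Re R \o f) -> continuous (@complex.Im R \o f) ->
  open (f @^-1` square w e).
Proof.
move=> cRe cIm.
rewrite (_ : f @^-1` _ = (@complex.Re R \o f) @^-1` ball (complex.Re w) e `&`
                        (@complex.Im R \o f) @^-1` ball (complex.Im w) e).
  by apply: openI; apply: open_comp => [? _|]; [exact: cRe| |exact: cIm|];
    exact: ball_open.
by apply/seteqP; split=> t; rewrite -!ball_normE /= (distrC (complex.Re w)) (distrC (complex.Im w)).
Qed.

(** Hypotheses and conclusion have the same form, so that the lemma applies
again to Cexp \o f, and the result feeds [open_preimage_square]. *)
Lemma continuous_ReIm_Cexp (T : topologicalType) (f : T -> R[i]) :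
  continuous (@complex.Re R \o f) -> continuous (@complex.Im R \o f) ->
  continuous (@complex.Re R \o (@Cexp R \o f)) /\
  continuous (@complex.Im R \o (@Cexp R \o f)).
Proof.
move=> cRe cIm.
have cE : continuous (expR \o (@complex.Re R \o f)).
  by move=> t; apply: continuous_comp; [exact: cRe|exact: continuous_expR].
split.
  rewrite (_ : _ \o _ = (expR \o (@complex.Re R \o f)) \* (cos \o (@complex.Im R \o f))).
    move=> t; apply: cvgM; first exact: cE.
    by apply: continuous_comp; [exact: cIm|exact: continuous_cos].
  by apply/funext => t /=; rewrite Re_Cexp.
rewrite (_ : _ \o _ = (expR \o (@complex.Re R \o f)) \* (sin \o (@complex.Im R \o f))).
  move=> t; apply: cvgM; first exact: cE.
  by apply: continuous_comp; [exact: cIm|exact: continuous_sin].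
by apply/funext => t /=; rewrite Im_Cexp.
Qed.

End Squares.

(** * Residual sets of slopes *)

(** The index set need not be nat: the naturals that encode no index contribute
the whole space. *)
Lemma Gdelta_dense_bigcap (T : topologicalType) (I : countType)
    (A : I -> set T) :
  (forall i, open (A i) /\ dense (A i)) -> Gdelta_dense (\bigcap_i A i).
Proof.
move=> hA; exists (fun n => if unpickle n is Some i then A i else setT).
  move=> n; case: unpickle => [//|]; split; first exact: openT.
  by move=> O O0 _; rewrite setIT.
apply/seteqP; split=> t tA.
  by move=> n _; case: unpickle => // i; exact: tA.
by move=> i _; have := tA (pickle i) Logic.I; rewrite pickleK.
Qed.

Section Slopes.
Context {R : realType}.

Definition hitting_slopes (p : R[i]) (S : set R[i]) : set R :=
  [set alpha | ((@Cexp R \o @Cexp R) @` line p alpha) `&` S !=set0].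

Lemma open_hitting_slopes p w e : open (hitting_slopes p (square w e)).
Proof.
pose f t (alpha : R) : R[i] := p + t%:C * ('i + alpha%:C).
rewrite (_ : hitting_slopes _ _ =
    \bigcup_t (@Cexp R \o (@Cexp R \o f t)) @^-1` square w e).
  apply: bigcup_open => t _.
  have cRe : continuous (@complex.Re R \o f t).
    rewrite (_ : _ \o _ = fun alpha => complex.Re p + t * alpha).
      by move=> alpha; apply: cvgD; [exact: cvg_cst|exact: mulrl_continuous].
    by apply/funext => alpha; rewrite /f; case: (p) => ? ? /=; ring.
  have cIm : continuous (@complex.Im R \o f t).
    rewrite (_ : _ \o _ = fun=> complex.Im p + t); first by move=> ?; exact: cvg_cst.
    by apply/funext => alpha; rewrite /f; case: (p) => ? ? /=; ring.
  have [cRe1 cIm1] := continuous_ReIm_Cexp cRe cIm.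
  have [cRe2 cIm2] := continuous_ReIm_Cexp cRe1 cIm1.
  exact: open_preimage_square.
apply/seteqP; split=> alpha.
  by move=> [_ [[_ [t _ <-] <-] sq]]; exists t.
move=> [t _ sq]; exists (Cexp (Cexp (f t alpha))); split=> //.
by exists (f t alpha) => //; exists t.
Qed.

Lemma dense_hitting_slopes p w e : 0 < e ->
  dense (hitting_slopes p (square w e)).
Proof.
move=> e0 O [x Ox] oO.
have /nbhs_ballP[d /= d0 dO] : nbhs x O by apply: open_nbhs_nbhs.
have [z z0 zw] := exists_neq0_square w e0.
(* A subinterval of the d-neighbourhood of x on which the sign is constant. *)
suff [a [b [xa ab bx ab0]]] : exists a b,
    [/\ x - d < a, a < b, b < x + d & 0 < a * b].
  have [alpha /andP[? ?] [u lu uz]] := line_hits p z0 ab ab0.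
  exists alpha; split; last by exists z; split=> //; exists u.
  by apply: dO; rewrite -ball_normE /= ltr_norml; apply/andP; split; lra.
have [x0|x0] := leP 0 x.
  by exists (x + d / 3), (x + d / 2); split; try lra; apply: mulr_gt0; lra.
by exists (x - d / 2), (x - d / 3); split; try lra; rewrite nmulr_rgt0; lra.
Qed.

End Slopes.

Theorem theorem2 (R : realType) (p : R[i]) :
  Gdelta_dense [set alpha : R |
    closure ((@Cexp R \o @Cexp R) @` line p alpha : set R[i]^o) = setT].
Proof.
rewrite (_ : [set _ | _] = \bigcap_i hitting_slopes p (rat_square i)).
  apply: Gdelta_dense_bigcap => i; split; first exact: open_hitting_slopes.
  by apply: dense_hitting_slopes; rewrite invr_gt0 ltr0n.
apply/seteqP; split=> alpha /=.
  by move=> /closure_eq_setT hS i _; exact: hS.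
by move=> hS; apply/closure_eq_setT => i; exact: hS.
Qed.
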